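(* Let $G$ be a finite group. A complete $G$-universe $\mathcal U$ is isovariantly weakly contractible. That is, for every strictly increasing chain $\mathbf H$ of subgroups of $G$, the space $\mathsf M_{\mathbf H}(\mathcal U)=\mathrm{Map}_{\mathrm{isvt}}(\Delta^{\mathbf H},\mathcal U)$ is weakly contractible.
   Context: $G$ is a finite group; all spaces are compactly generated, and mapping spaces carry the (compactly generated) compact-open topology. A $G$-space is a space with a continuous left $G$-action. An isovariant map $f: X\to Y$ of $G$-spaces is a continuous equivariant map whose isotropy groups satisfy $G_x=G_{f(x)}$ for all $x\in X$; $\mathrm{Map}_{\mathrm{isvt}}(X,Y)$ is the space of isovariant maps. For a strictly increasing chain of subgroups $\mathbf H=\{H_0<H_1<\dots<H_n\}$ of $G$ ($n\ge 0$), the linking simplex $\Delta^{\mathbf H}=\Delta^{\mathbf H}_G$ is the quotient of $G\times\Delta^n$ in which, for $x=(t_0,\dots,t_{n-k},0,\dots,0)$ with $t_{n-k}\neq 0$, $(g,x)\sim(g',x)$ if and only if $gH_k=g'H_k$; $G$ acts by left multiplication on the first coordinate. A complete $G$-universe $\mathcal U$ is any (real) $G$-representation isomorphic to $V_1^{\oplus\mathbb N}\oplus\cdots\oplus V_k^{\oplus\mathbb N}$, where $V_1,\dots,V_k$ are representatives of all irreducible $G$-representations; equivalently $\mathcal U\cong\rho^{\oplus\mathbb N}=\mathrm{colim}_{n\in\mathbb N}\,\rho^{\oplus n}$, where $\rho$ is the regular representation of $G$, with the colimit topology. *)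

(* Defs.v *)
From HB Require Import structures.
From mathcomp Require Import all_boot all_order all_algebra all_fingroup.
From mathcomp Require Import generic_quotient mxrepresentation character.
From mathcomp Require Import all_classical all_reals all_analysis.

Set Implicit Arguments.
Unset Strict Implicit.
Unset Printing Implicit Defensive.

Import Order.TTheory GRing.Theory Num.Theory.
Import numFieldNormedType.Exports.

Local Open Scope classical_set_scope.
Local Open Scope ring_scope.
Local Obligation Tactic := idtac.

(* [X] with its compactly generated topology: a set is open when its preimage
   under every continuous map from a compact Hausdorff space is open. *)
Definition kspace (X : Type) : Type := X.

Section Kification.
Variable X : topologicalType.

Definition kopen (A : set X) : Prop :=
  forall (K : topologicalType) (u : K -> X),
    compact [set: K] -> hausdorff_space K -> continuous u ->
    open (u @^-1` A).

Lemma kopenT : kopen setT.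
Proof. by move=> K u _ _ _; rewrite preimage_setT; exact: openT. Qed.

Lemma kopenI : setI_closed kopen.
Proof.
move=> A B oA oB K u cK hK cu; rewrite preimage_setI.
by apply: openI; [exact: oA|exact: oB].
Qed.

Lemma kopen_bigcup (I : Type) (f : I -> set X) :
  (forall i, kopen (f i)) -> kopen (\bigcup_i f i).
Proof.
move=> of_ K u cK hK cu; rewrite preimage_bigcup.
by apply: bigcup_open => i _; exact: of_.
Qed.

HB.instance Definition _ := Choice.copy (kspace X) X.
HB.instance Definition _ :=
  isOpenTopological.Build (kspace X) kopenT kopenI kopen_bigcup.

End Kification.

(* [gT] is discrete, so an action is jointly continuous when each group element
   acts continuously. *)
HB.mixin Record isGSpace (gT : finGroupType) X & Topological X := {
  gact : gT -> X -> X;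
  gact1 : forall x, gact 1%g x = x;
  gactM : forall g h x, gact (g * h)%g x = gact g (gact h x);
  gact_continuous : forall g, continuous (gact g)
}.

#[short(type="gSpaceType")]
HB.structure Definition GSpace (gT : finGroupType) :=
  {X of Topological X & isGSpace gT X}.

Definition isotropy (gT : finGroupType) (X : gSpaceType gT) (x : X) : {set gT} :=
  [set g | gact g x == x].

Definition isovariant (gT : finGroupType) (X Y : gSpaceType gT) (f : X -> Y) :=
  [/\ continuous f,
      forall (g : gT) x, f (gact g x) = gact g (f x) &
      forall x, isotropy x = isotropy (f x)].

Definition isvt_map (gT : finGroupType) (X Y : gSpaceType gT) : topologicalType :=
  kspace (set_type [set f : {compact-open, X -> Y} | isovariant f]).

(* G-representations, infinite-dimensional ones included; the topology is part
   of the data. *)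
HB.mixin Record isLinearGAction (gT : finGroupType) (R : numDomainType) U
    & GSpace gT U & GRing.Lmodule R U := {
  gact_linear : forall g : gT, linear (gact g : U -> U)
}.

#[short(type="gRepType")]
HB.structure Definition GRep (gT : finGroupType) (R : numDomainType) :=
  {U of GSpace gT U & GRing.Lmodule R U & isLinearGAction gT R U}.

Definition grep_iso (gT : finGroupType) (R : numDomainType)
    (U W : gRepType gT R) :=
  exists (f : U -> W) (f' : W -> U),
    [/\ linear f, forall (g : gT) u, f (gact g u) = gact g (f u),
        cancel f f', cancel f' f & continuous f /\ continuous f'].

Lemma mx_continuous (T U : topologicalType) m n (f : T -> 'M[U]_(m, n)) :
  (forall i j, continuous (fun x => f x i j)) -> continuous f.
Proof.
move=> cf x A [P Pf sPA]; rewrite nbhs_simpl /=.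
have : \forall y \near x, forall i j, P i j (f y i j).
  by apply: filter_forall => i; apply: filter_forall => j; exact/cf/Pf.
by apply: filterS => y Py; exact: sPA.
Qed.

Lemma mulmxr_continuous (R : realType) m n p (B : 'M[R]_(n, p)) :
  continuous (fun A : 'M[R]_(m, n) => A *m B).
Proof.
apply: mx_continuous => i j A; 
rewrite /continuous_at mxE.
under eq_cvg do rewrite mxE.
apply: cvg_big => [||l _]; first exact: add_continuous.
  exact: nbhs_filter.
by apply: cvgMr_tmp; [exact: (nbhs_filter A)|exact: coord_continuous].
Qed.


Section DirectSum.
Variables (R : realType) (gT : finGroupType) (k : nat).
Variable V : 'I_k -> representation R [set: gT].

(* V_0^(+)N (+) ... (+) V_(k-1)^(+)N, as families of vectors [v i m], lying in
   the [m]-th copy of [V i], with only finitely many nonzero entries. *)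
Record dsum := DSum {
  dsum_val :> forall i : 'I_k, nat -> 'rV[R]_(rdegree (V i));
  dsum_finite : exists N, forall i m, (N <= m)%N -> dsum_val i m = 0
}.

Lemma dsum_eq (u v : dsum) : (forall i m, u i m = v i m) -> u = v.
Proof.
case: u v => [u hu] [v hv] /= uv.
have {}uv : u = v.
  by apply: functional_extensionality_dep => i; apply/funext => m; exact: uv.
by case: _ / uv hv => hv; congr DSum; exact: Prop_irrelevance.
Qed.

HB.instance Definition _ := gen_eqMixin dsum.
HB.instance Definition _ := gen_choiceMixin dsum.

Program Definition dsum0 := @DSum (fun i m => 0) _.
Next Obligation. by exists 0%N. Qed.

Program Definition dsum_opp (u : dsum) := @DSum (fun i m => - u i m) _.
Next Obligation.
move=> [u [N hN]]; exists N => i m le_N_m /=.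
by rewrite hN// oppr0.
Qed.

Program Definition dsum_add (u v : dsum) := @DSum (fun i m => u i m + v i m) _.
Next Obligation.
move=> [u [N hN]] [v [M hM]]; exists (maxn N M) => i m /=.
by rewrite geq_max => /andP[le_N_m le_M_m]; rewrite hN// hM// addr0.
Qed.

Program Definition dsum_scale (a : R) (u : dsum) :=
  @DSum (fun i m => a *: u i m) _.
Next Obligation.
move=> a [u [N hN]]; exists N => i m le_N_m /=.
by rewrite hN// scaler0.
Qed.

Lemma dsum_addA : associative dsum_add.
Proof. by move=> u v w; apply: dsum_eq => i m /=; rewrite addrA. Qed.

Lemma dsum_addC : commutative dsum_add.
Proof. by move=> u v; apply: dsum_eq => i m /=; rewrite addrC. Qed.

Lemma dsum_add0 : left_id dsum0 dsum_add.
Proof. by move=> u; apply: dsum_eq => i m /=; rewrite add0r. Qed.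

Lemma dsum_addN : left_inverse dsum0 dsum_opp dsum_add.
Proof. by move=> u; apply: dsum_eq => i m /=; rewrite addNr. Qed.

HB.instance Definition _ :=
  GRing.isZmodule.Build dsum dsum_addA dsum_addC dsum_add0 dsum_addN.

Lemma dsum_scaleA a b u : dsum_scale a (dsum_scale b u) = dsum_scale (a * b) u.
Proof. by apply: dsum_eq => i m /=; rewrite scalerA. Qed.

Lemma dsum_scale1 : left_id 1 dsum_scale.
Proof. by move=> u; apply: dsum_eq => i m /=; rewrite scale1r. Qed.

Lemma dsum_scaleDr : right_distributive dsum_scale +%R.
Proof. by move=> a u v; apply: dsum_eq => i m /=; rewrite scalerDr. Qed.

Lemma dsum_scaleDl u : {morph dsum_scale^~ u : a b / a + b}.
Proof. by move=> a b; apply: dsum_eq => i m /=; rewrite scalerDl. Qed.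

HB.instance Definition _ := GRing.Zmodule_isLmodule.Build R dsum
  dsum_scaleA dsum_scale1 dsum_scaleDr dsum_scaleDl.

(* V_0^N (+) ... (+) V_(k-1)^N, the rows of a matrix being the [N] copies. *)
Definition dsum_stage (N : nat) : topologicalType :=
  prod_topology (fun i : 'I_k => 'M[R]_(N, rdegree (V i))).

Program Definition dsum_incl (N : nat) (v : dsum_stage N) : dsum :=
  @DSum (fun i m => oapp (fun j : 'I_N => row j (v i)) 0 (insub m)) _.
Next Obligation.
by move=> N v; exists N => i m le_N_m; rewrite insubN// -leqNgt.
Qed.

(* The colimit topology of the finite stages. *)
Definition dsum_open (A : set dsum) : Prop :=
  forall N, open (@dsum_incl N @^-1` A).

Lemma dsum_openT : dsum_open setT.
Proof. by move=> N; rewrite preimage_setT; exact: openT. Qed.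

Lemma dsum_openI : setI_closed dsum_open.
Proof. by move=> A B oA oB N; rewrite preimage_setI; exact: openI. Qed.

Lemma dsum_open_bigcup (I : Type) (f : I -> set dsum) :
  (forall i, dsum_open (f i)) -> dsum_open (\bigcup_i f i).
Proof.
move=> of_ N; rewrite preimage_bigcup.
by apply: bigcup_open => i _; exact: of_.
Qed.

HB.instance Definition _ :=
  isOpenTopological.Build dsum dsum_openT dsum_openI dsum_open_bigcup.

Lemma dsum_openE (A : set dsum) : open A <-> dsum_open A.
Proof. by []. Qed.

(* MathComp matrices act on row vectors on the right, so [g] acts on the left
   through its inverse. *)
Program Definition dsum_act (g : gT) (u : dsum) : dsum :=
  @DSum (fun i m => u i m *m V i g^-1%g) _.
Next Obligation.
move=> g [u [N hN]]; exists N => i m le_N_m /=.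
by rewrite hN// mul0mx.
Qed.

Lemma dsum_act1 u : dsum_act 1%g u = u.
Proof.
by apply: dsum_eq => i m /=; rewrite invg1 repr_mx1 mulmx1.
Qed.

Lemma dsum_actM g h u : dsum_act (g * h)%g u = dsum_act g (dsum_act h u).
Proof.
by apply: dsum_eq => i m /=; rewrite invMg repr_mxM ?inE// mulmxA.
Qed.

Lemma dsum_act_linear g : linear (dsum_act g).
Proof.
by move=> a u v; apply: dsum_eq => i m /=; rewrite mulmxDl scalemxAl.
Qed.

Lemma dsum_act_continuous g : continuous (dsum_act g).
Proof.
apply/continuousP => A oA; apply/dsum_openE => N.
pose act_stage (v : dsum_stage N) : dsum_stage N :=
  fun i => v i *m V i g^-1%g.
have actE v : dsum_act g (dsum_incl v) = dsum_incl (act_stage v).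
  apply: dsum_eq => i m /=; case: insubP => [j _ _|_] /=.
    by rewrite row_mul.
  by rewrite mul0mx.
rewrite -comp_preimage (_ : _ \o _ = @dsum_incl N \o act_stage); last first.
  by apply/funext => v; exact: actE.
rewrite comp_preimage; have /continuousP : continuous act_stage.
  move=> v; apply/cvg_sup => [|i].
    exact: (fmap_filter act_stage (nbhs_filter v)).
  apply: (@continuous_comp_initial _ _ _ (@^~ i)) => w.
  apply: (@continuous_comp (dsum_stage N) 'M[R]_(N, rdegree (V i))
    'M[R]_(N, rdegree (V i)) (fun u => u i) (mulmx^~ (V i g^-1%g))).
    exact: (@proj_continuous _ (fun i => 'M[R]_(N, rdegree (V i)))).
  exact: mulmxr_continuous.
by apply; move/dsum_openE : oA; apply.
Qed.

HB.instance Definition _ := isGSpace.Build gT dsum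
  dsum_act1 dsum_actM dsum_act_continuous.
HB.instance Definition _ := isLinearGAction.Build gT R dsum dsum_act_linear.

End DirectSum.

Definition irr_representatives (R : realType) (gT : finGroupType) (k : nat)
    (V : 'I_k -> representation R [set: gT]) :=
  [/\ forall i, mx_irreducible (V i),
      forall i j, mx_rsim (V i) (V j) -> i = j &
      forall W : representation R [set: gT],
        mx_irreducible W -> exists i, mx_rsim W (V i)].

Definition complete_universe (R : realType) (gT : finGroupType)
    (U : gRepType gT R) :=
  exists (k : nat) (V : 'I_k -> representation R [set: gT]),
    irr_representatives V /\ grep_iso U (dsum V).

Definition simplex (R : realType) (n : nat) : topologicalType :=
  set_type [set t : 'rV[R]_n.+1 |
    (forall i, 0 <= t 0 i) /\ \sum_i t 0 i = 1].

Section LinkingSimplex.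
Local Open Scope quotient_scope.
Variables (R : realType) (gT : finGroupType) (n : nat).
Variable H : 'I_n.+1 -> {group gT}.

(* [x = (t_0, ..., t_(n-k), 0, ..., 0)] with [t_(n-k)] nonzero. *)
Definition last_nonzero (x : simplex R n) (k : 'I_n.+1) : bool :=
  (set_val x 0 (rev_ord k) != 0) &&
  [forall j : 'I_n.+1, (rev_ord k < j)%N ==> (set_val x 0 j == 0)].

(* Exactly one [k] satisfies [last_nonzero x k]. *)
Definition link_eq (p q : discrete_topology gT * simplex R n) : bool :=
  (p.2 == q.2) &&
  [forall k, last_nonzero p.2 k ==>
     (((p.1 : gT) *: H k)%g == ((q.1 : gT) *: H k)%g)].

Lemma link_eq_refl : reflexive link_eq.
Proof.
by move=> p; rewrite /link_eq eqxx; apply/forallP => k; rewrite eqxx implybT.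
Qed.

Lemma link_eq_sym : symmetric link_eq.
Proof.
move=> [g x] [h y]; rewrite /link_eq /= eq_sym.
by case: eqP => //= ->; apply: eq_forallb => k; rewrite eq_sym.
Qed.

Lemma link_eq_trans : transitive link_eq.
Proof.
move=> [h y] [g x] [l z]; rewrite /link_eq /=.
move=> /andP[/eqP <- /forallP gh] /andP[/eqP <- /forallP hl].
rewrite eqxx; apply/forallP => k; apply/implyP => xk.
by rewrite (eqP (implyP (gh k) xk)) (eqP (implyP (hl k) xk)).
Qed.

Definition link_rel := EquivRel _ link_eq_refl link_eq_sym link_eq_trans.

Definition linking_simplex := {eq_quot link_rel}.

HB.instance Definition _ :=
  Topological.copy linking_simplex (quotient_topology linking_simplex).
HB.instance Definition _ := Quotient.on linking_simplex.

Local Notation pi := \pi_linking_simplex.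

Lemma link_piP p q : reflect (pi p = pi q) (link_eq p q).
Proof. exact: (@eqmodP _ link_rel). Qed.

Definition link_act (g : gT) (z : linking_simplex) : linking_simplex :=
  pi ((g * (repr z).1)%g : discrete_topology gT, (repr z).2).

Lemma link_act_pi g (h : gT) (x : simplex R n) :
  link_act g (pi (h : discrete_topology gT, x)) =
  pi ((g * h)%g : discrete_topology gT, x).
Proof.
rewrite /link_act; apply/link_piP => /=.
have /link_piP : pi (repr (pi (h : discrete_topology gT, x))) = pi (h, x).
  exact: reprK.
case: (repr _) => h' x' /=; rewrite /link_eq /=.
move=> /andP[-> /forallP hh']; apply/forallP => k; apply/implyP => xk.
by rewrite !lcosetM (eqP (implyP (hh' k) xk)).
Qed.

Lemma link_act1 z : link_act 1%g z = z.
Proof. by rewrite -[z]reprK; case: (repr z) => h x; rewrite link_act_pi mul1g. Qed.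

Lemma link_actM g h z : link_act (g * h)%g z = link_act g (link_act h z).
Proof.
rewrite -[z]reprK; case: (repr z) => l x.
by rewrite (link_act_pi (g * h)%g) (link_act_pi h) (link_act_pi g) mulgA.
Qed.

Lemma link_act_continuous g : continuous (link_act g).
Proof.
apply/quotient_continuous.
pose trans (p : discrete_topology gT * simplex R n) :=
  ((g * p.1)%g : discrete_topology gT, p.2).
rewrite (_ : _ \o _ = pi \o trans); last first.
  by apply/funext => -[h x]; exact: link_act_pi.
move=> p; apply: continuous_comp; last exact: pi_continuous.
have cg : continuous (fun h : discrete_topology gT =>
    (g * h)%g : discrete_topology gT).
  by apply/continuousP => A _; exact: discrete_open.
have c1 : continuous (fun q : discrete_topology gT * simplex R n =>
    (g * q.1)%g : discrete_topology gT).
  by move=> q; apply: continuous_comp; [exact: cvg_fst|exact: cg].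
have c2 : continuous (fun q : discrete_topology gT * simplex R n => q.2).
  by move=> q; exact: cvg_snd.
exact: (cvg_pair (c1 p) (c2 p)).
Qed.

HB.instance Definition _ := isGSpace.Build gT linking_simplex
  link_act1 link_actM link_act_continuous.

End LinkingSimplex.

Definition cube (R : realType) (n : nat) : topologicalType :=
  set_type [set s : 'rV[R]_n | forall i, 0 <= s 0 i <= 1].

Definition cube_boundary (R : realType) (n : nat) (s : cube R n) : Prop :=
  exists i, set_val s 0 i = 0 \/ set_val s 0 i = 1.

Definition unit_interval (R : realType) : topologicalType :=
  set_type (`[0, 1] : set R).

(* [f : (I^n, bd I^n) -> (X, x0)] represents the neutral element of
   [pi_n(X, x0)]. As [cube R 0] is a point without boundary, the case n = 0 says
   that a path joins [f] to [x0]. *)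
Definition null_homotopic_rel (R : realType) (X : topologicalType) (n : nat)
    (x0 : X) (f : cube R n -> X) :=
  exists h : cube R n * unit_interval R -> X,
    [/\ continuous h,
        forall s t, set_val t = 0 -> h (s, t) = f s,
        forall s t, set_val t = 1 -> h (s, t) = x0 &
        forall s t, cube_boundary s -> h (s, t) = x0].

(* Nonempty, path connected, with trivial homotopy groups at every base point:
   the map to a point is a weak homotopy equivalence. *)
Definition weakly_contractible (R : realType) (X : topologicalType) :=
  [set: X] !=set0 /\
  forall (n : nat) (x0 : X) (f : cube R n -> X),
    continuous f -> (forall s, cube_boundary s -> f s = x0) ->
    null_homotopic_rel x0 f.

(* Main.v *)
From mathcomp Require Import all_boot all_order all_algebra all_fingroup.
From mathcomp Require Import zify.
From mathcomp Require Import generic_quotient mxrepresentation character.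
From mathcomp Require Import all_classical all_reals all_analysis.
Require Import Defs.

(** Why the theorem holds.

    Write [L] for the linking simplex and identify [U] with the colimit of the
    finite stages of the direct sum [dsum V].

    The source of contractibility is room: for every [N] there is an isovariant
    map [e : L -> dsum V] all of whose values vanish in the copies of index
    below [N] ([exists_isovariant_dsum]).  Such a map is affine over the simplex:
    pick vectors [v_j] whose stabilisers are exactly the groups of the chain,
    lying in pairwise disjoint blocks of copies, and send [g, x] to
    the sum of the [x_j *: g v_j].  As the blocks are disjoint, an element fixes
    the sum iff it fixes each [g v_j] with [x_j] nonzero, which is the
    description of the isotropy groups of [L] ([isotropy_link_pt]).  A vector
    with stabiliser exactly [K] exists because every [g] outside [K] moves some
    [K]-fixed vector of some irreducible representation ([irr_moved]): the
    indicator of [K] in the regular representation is [K]-fixed and moved by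
    [g], and by Maschke it has an irreducible component with the same property
    ([irr_separates]).  Summing one such vector for each [g], each in a copy of
    its own, leaves no stabiliser but [K].

    Now let [f : I^n -> Map(L, U)] be constant equal to [x0] on the boundary.  As
    [I^n * L] is compact, [f] and [x0] take their values in the first [N] copies
    for some [N] ([compact_dsum_bounded]).  With [e] vanishing on these copies,
      [h(s, t) = (1 - t) f(s) + t x0 + t (1 - t) bump(s) e]
    goes from [f] to [x0], and is [x0] on the boundary, where [bump] vanishes.
    Wherever the last coefficient is nonzero the component of [h(s, t)] in the
    copies of index at least [N] is a nonzero multiple of [e], so the isotropy
    is not larger than that of [e]; it is not smaller either, since [f(s)], [x0]
    and [e] have the same isotropy ([isotropy_dsum_perturb]).  Elsewhere
    [h(s, t)] is [f(s)] or [x0].  So [h] stays among isovariant maps.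

    Continuity of [h] is checked on the adjoint map [I^n * I * L -> U], which
    needs [L] to be compact Hausdorff; since [I^n * I] is compact Hausdorff,
    passing to the compactly generated topology on the mapping space costs
    nothing. *)

Set Implicit Arguments.
Unset Strict Implicit.
Unset Printing Implicit Defensive.

Import Order.TTheory GRing.Theory Num.Theory.
Import numFieldNormedType.Exports.

Local Open Scope classical_set_scope.
Local Open Scope ring_scope.

(** * Compact Hausdorff spaces and mapping spaces *)

Section Topology.

Lemma set_val_continuous (X : topologicalType) (A : set X) :
  continuous (set_val : set_type A -> X).
Proof. exact: initial_continuous. Qed.

Lemma compact_set_type (X : topologicalType) (A : set X) :
  compact A -> compact [set: set_type A].
Proof.
move=> cA F FF _.
have FA : (fmap set_val F) A.
  by apply: (@filterE _ F) => x; exact: (@set_valP _ A x).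
have [a [Aa cl]] := cA _ (fmap_proper_filter set_val FF) FA.
exists (SigSub (mem_set Aa)); split=> // B C FB [D [[E oE ED] Da DC]].
have [_ [[b Bb <-] Eb]] : (set_val @` B) `&` E !=set0.
  apply: cl; first by apply: (@filterS _ F _ B) => // b Bb; exists b.
  by apply: open_nbhs_nbhs; split=> //; rewrite -ED in Da.
by exists b; split=> //; apply: DC; rewrite -ED.
Qed.

(** A cluster point is preserved by continuous maps, and is a limit in [R].
    This is how quotients and products are shown to be Hausdorff below. *)
Lemma hausdorff_separating (R : realType) (X : topologicalType) :
  (forall x y : X, (forall f : X -> R, continuous f -> f x = f y) -> x = y) ->
  hausdorff_space X.
Proof.
move=> sepX x y clxy; apply: sepX => f cf; apply: Rhausdorff => A B fxA fyB.
by have [z [Az Bz]] := clxy _ _ (cf x _ fxA) (cf y _ fyB); exists (f z).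
Qed.

(** The test maps that define the topology of [kspace X] include [u] itself, so
    a compact Hausdorff source does not see the difference between [X] and
    [kspace X]. *)
Lemma continuous_kspace (K X : topologicalType) (u : K -> X) :
  compact [set: K] -> hausdorff_space K -> continuous u ->
  continuous (u : K -> kspace X).
Proof. by move=> cK hK cu; apply/continuousP => A oA; exact: (oA K u). Qed.

Lemma kspace_continuous (K X : topologicalType) (u : K -> kspace X) :
  continuous u -> continuous (u : K -> X).
Proof.
move=> /continuousP cu; apply/continuousP => A oA; apply: cu.
have kA : kopen A by move=> L v _ _ /continuousP cv; exact: cv.
exact: kA.
Qed.

Lemma compactT_setX (X Y : topologicalType) :
  compact [set: X] -> compact [set: Y] -> compact [set: X * Y].
Proof. by move=> cX cY; rewrite -setXTT; exact: compact_setX. Qed.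

Lemma compact_hausdorff_uncurry (T L Y : topologicalType)
    (f : T -> {compact-open, L -> Y}) :
  compact [set: L] -> hausdorff_space L -> continuous f ->
  (forall t, continuous (f t)) -> continuous (uncurry f : T * L -> Y).
Proof.
move=> cL hL; apply: continuous_uncurry => // x _.
by exists setT; [rewrite withinET; exact: filterT|split=> //; exact: closedT].
Qed.

Lemma open_forall_neq (T : topologicalType) (I : finType) (P : pred I)
    (Y : I -> topologicalType) (f : forall i, T -> Y i) (c : forall i, Y i) :
  (forall i, hausdorff_space (Y i)) -> (forall i, continuous (f i)) ->
  open [set v | forall i, P i -> f i v != c i].
Proof.
move=> hY cf; rewrite openE => v vP.
suff near_i i : nbhs v [set w | P i -> f i w != c i] by exact: filter_forall.
have [Pi|_] := boolP (P i); last exact: filterE.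
have oci : open [set y : Y i | y != c i].
  rewrite (_ : [set y | _] = ~` [set c i]); last first.
    by apply/seteqP; split=> y /= /eqP.
  by apply: closed_openC; apply/accessible_closed_set1/hausdorff_accessible.
have near_neq : nbhs v (f i @^-1` [set y | y != c i]).
  by apply: cf; apply: open_nbhs_nbhs; split=> //; exact: vP.
by apply: filterS near_neq => w wc _; exact: wc.
Qed.

Lemma continuous_pair (T Y Z : topologicalType) (f : T -> Y) (g : T -> Z) :
  continuous f -> continuous g -> continuous (fun t => (f t, g t)).
Proof. by move=> cf cg t; exact: (cvg_pair (cf t) (cg t)). Qed.

End Topology.

(** * Cubes and simplices *)

Section Cube.
Variable R : realType.

Lemma compact_unit_box n :
  compact [set v : 'rV[R]_n | forall i, 0 <= v 0 i <= 1].
Proof.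
have cI : compact [set x : R | 0 <= x <= 1].
  by rewrite -set_itvcc; exact: segment_compact.
exact: (@rV_compact R n (fun=> [set x : R | 0 <= x <= 1]) (fun=> cI)).
Qed.

Lemma compact_cube n : compact [set: cube R n].
Proof. exact: (compact_set_type (@compact_unit_box n)). Qed.

Lemma compact_unit_interval : compact [set: unit_interval R].
Proof. exact: (compact_set_type (@segment_compact R 0 1)). Qed.

Lemma cube_coord_continuous n (i : 'I_n) :
  continuous (fun s : cube R n => set_val s 0 i).
Proof.
move=> s; apply: (@continuous_comp _ _ _ _ (fun v : 'rV[R]_n => v 0 i)).
  exact: set_val_continuous.
exact: coord_continuous.
Qed.

Lemma hausdorff_cube_cylinder n :
  hausdorff_space (cube R n * unit_interval R)%type.
Proof.
apply: (@hausdorff_separating R) => -[s t] [s' t'] sep; congr pair.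
  apply/val_inj/rowP => i.
  apply: (sep (fun p => set_val p.1 0 i)) => p.
  apply: (@continuous_comp _ _ _ fst (fun s : cube R n => set_val s 0 i)).
    exact: cvg_fst.
  exact: cube_coord_continuous.
apply/val_inj.
apply: (sep (fun p => set_val p.2)) => p.
apply: (@continuous_comp _ _ _ snd (set_val : unit_interval R -> R)).
  exact: cvg_snd.
exact: set_val_continuous.
Qed.

Lemma compact_simplex n : compact [set: simplex R n].
Proof.
suff cA : compact [set t : 'rV[R]_n.+1 |
    (forall i, 0 <= t 0 i) /\ \sum_i t 0 i = 1] by exact: (compact_set_type cA).
apply: (subclosed_compact _ (@compact_unit_box n.+1)).
  have -> : [set t : 'rV[R]_n.+1 | (forall i, 0 <= t 0 i) /\ \sum_i t 0 i = 1] =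
    (\bigcap_i [set t : 'rV[R]_n.+1 | 0 <= t 0 i]) `&`
    [set t | \sum_i t 0 i = 1].
    apply/seteqP; split=> v /= [v0 v1]; split=> // i; [by move=> _; exact: v0|].
    exact: v0.
  apply: closedI.
    apply: closed_bigI => i _.
    apply: (@preimage_closed _ _ (fun v : 'rV[R]_n.+1 => v 0 i) [set x | 0 <= x]).
      by move=> v _; exact: (@coord_continuous R 1 n.+1 0 i).
    exact: closed_ge.
  apply: (@preimage_closed _ _ (fun v : 'rV[R]_n.+1 => \sum_i v 0 i) [set 1]).
    move=> v _; apply: cvg_big => [||i _]; first exact: add_continuous.
      exact: nbhs_filter.
    exact: (@coord_continuous R 1 n.+1 0 i).
  exact: closed_eq.
move=> v [v0 v1] i /=; rewrite v0 /= -v1 (bigD1 i) //= lerDl.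
by apply: sumr_ge0 => j _; exact: v0.
Qed.

End Cube.

(** * The colimit topology of the direct sum *)

Section DirectSumTopology.
Variables (R : realType) (gT : finGroupType) (k : nat).
Variable V : 'I_k -> representation R [set: gT].

Lemma dsum_incl_continuous N : continuous (@dsum_incl R gT k V N).
Proof. by apply/continuousP => A /dsum_openE; exact. Qed.

Lemma dsum_coord_continuous i m : continuous (fun u : dsum V => u i m).
Proof.
apply/continuousP => A oA; apply/dsum_openE => N.
rewrite -comp_preimage; suff /continuousP : continuous
  ((fun u : dsum V => u i m) \o @dsum_incl R gT k V N) by exact.
have [mN|Nm] := ltnP m N; last first.
  rewrite (_ : _ \o _ = cst 0); first exact: cst_continuous.
  by apply/funext => v /=; rewrite insubN// -leqNgt.
rewrite (_ : _ \o _ = row (Ordinal mN) \o (fun v : dsum_stage V N => v i));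
  last by apply/funext => v /=; rewrite insubT.
move=> v; apply: continuous_comp.
  exact: (@proj_continuous _ (fun i => 'M[R]_(N, rdegree (V i)))).
apply: mx_continuous => a b w; under eq_fun do rewrite mxE.
exact: coord_continuous.
Qed.

(** As the supports are bounded by a common [N], the map factors through the
    [N]-th stage, where continuity is checked coordinatewise.  Without the bound
    this fails: the colimit topology is finer than that of the product. *)
Lemma dsum_continuous (T : topologicalType) (N : nat) (F : T -> dsum V) :
  (forall t i m, (N <= m)%N -> F t i m = 0) ->
  (forall i m, continuous (fun t => F t i m)) -> continuous F.
Proof.
move=> F0 cF.
pose G t : dsum_stage V N := fun i => \matrix_(j < N) F t i j.
have -> : F = @dsum_incl R gT k V N \o G.
  apply/funext => t; apply: dsum_eq => i m /=.
  case: insubP => [j _ <-|] /=; first by rewrite rowK.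
  by rewrite -leqNgt => /F0.
move=> t; apply: continuous_comp; last exact: dsum_incl_continuous.
apply/cvg_sup => i.
apply: (@continuous_comp_initial _ _ _ (@^~ i)) => w.
apply: mx_continuous => a b z.
rewrite (_ : (fun x => _) = (fun v : 'rV_(rdegree (V i)) => v 0 b) \o
  (fun t => F t i a)); last by apply/funext => x /=; rewrite mxE.
by apply: continuous_comp; [exact: cF|exact: coord_continuous].
Qed.

(** A compact subset of the colimit lies in a finite stage.  Choose in every
    copy [m] where [F] is not identically zero a nonzero value [q m] that it
    takes, and let [A N] consist of the vectors that avoid [q m] in all copies
    [m >= N].  The sets [A N] are open in the colimit topology, since only
    finitely many conditions are visible in each stage, and they increase to the
    whole space; by compactness one of them contains the image of [F], which
    therefore vanishes in all copies [m >= N]. *)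
Lemma compact_dsum_bounded (K : topologicalType) (F : K -> dsum V) :
  compact [set: K] -> continuous F ->
  exists N, forall t i m, (N <= m)%N -> F t i m = 0.
Proof.
move=> cK cF.
pose q i m : 'rV[R]_(rdegree (V i)) :=
  if pselect (exists t, F t i m != 0) is left e then F (projT1 (cid e)) i m
  else 0.
have qP i m : (q i m = 0 -> forall t, F t i m = 0) /\
              (q i m != 0 -> exists t, F t i m = q i m).
  rewrite /q; case: pselect => [e|F0].
    by case: cid => t /= Ft; split=> [/eqP|_]; [rewrite (negbTE Ft)|exists t].
  split=> [_ t|]; last by rewrite eqxx.
  by apply/eqP/negPn/negP => Ft; apply: F0; exists t.
pose A (N : nat) : set (dsum V) :=
  [set u | forall i m, (N <= m)%N -> q i m != 0 -> u i m != q i m].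
have oA N : open (A N).
  apply/dsum_openE => M.
  pose f (p : 'I_k * 'I_M) (v : dsum_stage V M) := dsum_incl v p.1 p.2.
  have cf p : continuous (f p).
    move=> v; apply: (@continuous_comp _ _ _ (@dsum_incl _ _ _ V M)
      (fun u : dsum V => u p.1 p.2)); first exact: dsum_incl_continuous.
    exact: dsum_coord_continuous.
  have := @open_forall_neq _ ('I_k * 'I_M)%type
    (fun p => (N <= p.2)%N && (q p.1 p.2 != 0)) _ f (fun p => q p.1 p.2)
    (fun p => @norm_hausdorff _ _) cf.
  congr open; apply/seteqP; split=> v Av.
    move=> i m Nm q0; have [mM|Mm] := ltnP m M.
      by apply: (Av (i, Ordinal mM)); rewrite Nm.
    by rewrite /= insubN -?leqNgt //; apply: contra q0 => /eqP <-.
  by move=> [i m] /= /andP[Nm q0]; exact: Av.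
have [N _ FN] : \forall N \near \oo, [set: K] `<=` (fun t => A N (F t)).
  apply: (iffLR (compact_near_coveringP _) cK) => t _.
  have [N FtN] := dsum_finite (F t).
  exists (F @^-1` A N, [set M | N <= M]%N).
    split; last by exists N.
    apply: (cF t); apply: open_nbhs_nbhs; split=> // i m Nm.
    by rewrite FtN// eq_sym.
  by move=> [t' M] /= [At' NM] i m Mm; apply: At'; exact: leq_trans Mm.
exists N => t i m Nm.
have [q0|q0] := eqVneq (q i m) 0; first by apply: (qP i m).1.
have [t' Ft'] := (qP i m).2 q0.
by have := FN N (leqnn N) t' I i m Nm q0; rewrite Ft' eqxx.
Qed.

(** Addition and scaling are only needed on maps with compact source: these have
    bounded support, so that the operations take place in a finite stage and the
    joint continuity of addition on the whole colimit is not at issue. *)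
Lemma compact_dsum_add_continuous (K : topologicalType) (F G : K -> dsum V) :
  compact [set: K] -> continuous F -> continuous G ->
  continuous (fun x => F x + G x).
Proof.
move=> cK cF cG; have [N FN] := compact_dsum_bounded cK cF.
have [M GM] := compact_dsum_bounded cK cG.
apply: (@dsum_continuous _ (maxn N M)) => [x i m|i m x].
  by rewrite geq_max => /andP[Nm Mm] /=; rewrite FN// GM// addr0.
apply: cvgD.
  apply: (@continuous_comp _ _ _ F (fun u : dsum V => u i m)); first exact: cF.
  exact: dsum_coord_continuous.
apply: (@continuous_comp _ _ _ G (fun u : dsum V => u i m)); first exact: cG.
exact: dsum_coord_continuous.
Qed.

Lemma compact_dsum_scale_continuous (K : topologicalType) (a : K -> R)
    (F : K -> dsum V) :
  compact [set: K] -> continuous a -> continuous F ->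
  continuous (fun x => a x *: F x).
Proof.
move=> cK ca cF; have [N FN] := compact_dsum_bounded cK cF.
apply: (@dsum_continuous _ N) => [x i m Nm|i m x] /=.
  by rewrite FN// scaler0.
apply: cvgZ; first exact: ca.
apply: (@continuous_comp _ _ _ F (fun u : dsum V => u i m)); first exact: cF.
exact: dsum_coord_continuous.
Qed.

End DirectSumTopology.

(** * Vectors with a prescribed stabiliser *)

Section Representations.
Variables (R : realType) (gT : finGroupType) (k : nat).
Variable V : 'I_k -> representation R [set: gT].
Hypothesis irrV : irr_representatives V.

(** By induction on the rank of the submodule [U]: if [U] is simple, it is one of
    the [V i] and [w] can be transported there; otherwise Maschke splits [U]
    into two smaller submodules, the components of [w] are still [K]-fixed as
    the projections are equivariant, and [g] moves one of them. *)
Lemma irr_separates n (rG : mx_representation R [set: gT]%G n)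
    (K : {group gT}) (g : gT) (U : 'M[R]_n) (w : 'rV[R]_n) :
  mxmodule rG U -> (w <= U)%MS ->
  (forall x, x \in K -> w *m rG x = w) -> w *m rG g != w ->
  exists i (v : 'rV[R]_(rdegree (V i))),
    (forall x, x \in K -> v *m V i x = v) /\ v *m V i g != v.
Proof.
move=> modU wU wK wg.
have [d] := ubnP (\rank U); elim: d => // d IHd in U w modU wU wK wg *.
rewrite ltnS => rU.
have [simU|nsimU] := pselect (mxsimple rG U).
  (* The universe contains [U] up to a change of basis [B]. *)
  pose W := Representation (submod_repr modU).
  have irrW : mx_irreducible W by apply/submod_mx_irr.
  have [i [B dimB freeB BE]] : exists i, mx_rsim W (V i).
    by case: irrV => _ _; exact.
  exists i, (in_submod U w *m B); split=> [x xK|].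
    by rewrite -mulmxA -BE ?inE// mulmxA -in_submodJ// wK.
  rewrite -mulmxA -BE ?inE// mulmxA -in_submodJ//.
  apply: contra wg => /eqP /(row_free_inj freeB) /(congr1 (val_submod (U := U))).
  by rewrite !in_submodK// => [->//|]; apply: mxmodule_trans => //; rewrite inE.
have [U0|nzU] := eqVneq U 0.
  by move: wU wg; rewrite U0 submx0 => /eqP ->; rewrite mul0mx eqxx.
have [U1 /and4P[modU1 sU1 nzU1 rU1]] : mxnonsimple rG U.
  by apply: contrapT => nnU; apply: nsimU; apply/mxsimpleP.
have redU : mx_completely_reducible rG U.
  apply: mx_reducibleS modU (submx1 U) _; apply: mx_Maschke_pchar.
  apply: sub_in_pnat (pnat_pi (cardG_gt0 _)) => p _ _.
  by rewrite !inE pnatr_eq0; case: p => [|p]; rewrite ?andbF.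
have [U2 modU2 defU /mxdirect_addsP dxU] := redU U1 modU1 sU1.
have dxU' : (U2 :&: U1 = 0)%MS by rewrite capmxC.
have sw : (w <= U1 + U2)%MS by rewrite defU.
have rU2 : (\rank U2 < \rank U)%N.
  by rewrite -defU mxrank_disjoint_sum// -[ltnLHS]add0n ltn_add2r lt0n mxrank_eq0.
have projJ A B x : mxmodule rG A -> mxmodule rG B -> (A :&: B = 0)%MS ->
    (w <= A + B)%MS ->
    w *m rG x *m proj_mx A B = w *m proj_mx A B *m rG x.
  move=> mA mB AB wAB.
  by have /hom_mxP := submx_trans wAB (proj_mx_hom AB mA mB); apply; rewrite inE.
have [w1|w1] := eqVneq (w *m proj_mx U1 U2 *m rG g) (w *m proj_mx U1 U2);
    last first.
  apply: (IHd U1 _ modU1 (proj_mx_sub _ _ _) _ w1); last exact: leq_trans rU1 rU.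
  by move=> x xK; rewrite -projJ// wK.
apply: (IHd U2 (w *m proj_mx U2 U1) modU2 (proj_mx_sub _ _ _)).
- by move=> x xK; rewrite -projJ ?wK// addsmxC.
- apply: contra wg => /eqP w2.
  by rewrite -{1}(add_proj_mx dxU sw) mulmxDl w1 w2 add_proj_mx.
- exact: leq_trans rU2 rU.
Qed.

(** The witness comes from the regular representation, where the indicator
    vector of [K] has stabiliser [K]. *)
Lemma irr_moved (K : {group gT}) (g : gT) : g \notin K ->
  exists i (v : 'rV[R]_(rdegree (V i))),
    (forall x, x \in K -> v *m V i x = v) /\ v *m V i g != v.
Proof.
move=> gK; pose G := [set: gT]%G.
pose w : 'rV[R]_#|G| := \sum_(h in K) delta_mx 0 (gring_index G h).
have wE x : w *m regular_repr R G x =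
    \sum_(h in K) delta_mx 0 (gring_index G (h * x)%g).
  rewrite mulmx_suml; apply: eq_bigr => h _.
  by rewrite -rowE rowK gring_indexK ?inE.
have giE x y : (gring_index G x == gring_index G y) = (x == y).
  apply/eqP/eqP => [xy|->//]; have := congr1 enum_val xy.
  by rewrite !gring_indexK ?inE.
apply: (@irr_separates _ (regular_repr R G) K g 1%:M w (mxmodule1 _)).
- exact: submx1.
- move=> x xK; rewrite wE [RHS](reindex_inj (mulIg x)) /=.
  by apply: eq_bigl => h; rewrite groupMr.
- (* The coordinate at the identity is 1 in [w], but 0 in its translate by [g],
     since the inverse of [g] is not in [K]. *)
  rewrite wE; apply/negP => /eqP/rowP/(_ (gring_index G 1%g)).
  rewrite !summxE big1 => [|h hK]; last first.
    rewrite mxE eqxx giE /= (_ : (1 == h * g)%g = false)//.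
    apply: contraNF gK => /eqP hg; rewrite -[g](mulKg h) -hg mulg1.
    by rewrite groupV.
  rewrite (bigD1 1%g) ?group1//= big1 => [|h /andP[_ h1]].
    by rewrite mxE !eqxx addr0 => /eqP; rewrite eq_sym oner_eq0.
  by rewrite mxE eqxx giE eq_sym (negbTE h1).
Qed.

(** One copy is reserved for each group element [g]; it holds a [K]-fixed vector
    that is moved by [g] when [g] is not in [K].  The explicit block of copies
    allows several such vectors to be placed side by side. *)
Lemma exists_dsum_isotropy (K : {group gT}) (N : nat) :
  exists2 u : dsum V,
    forall i m, ~~ (N <= m < N + #|gT|)%N -> u i m = 0 &
    isotropy u = K.
Proof.
have /choice[w wP] : forall g, exists w : forall i, 'rV[R]_(rdegree (V i)),
    (forall i x, x \in K -> w i *m V i x = w i) /\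
    (g \notin K -> exists i, w i *m V i g != w i).
  move=> g; have [gK|gK] := boolP (g \in K).
    by exists (fun i => 0); split=> // i x _; rewrite mul0mx.
  have [i [v [vK vg]]] := irr_moved gK.
  exists (@dfwith _ (fun i => 'rV[R]_(rdegree (V i))) (fun=> 0) i v).
  split=> [j x xK|_]; last first.
    by exists i; rewrite dfwithin.
  have [<-|ij] := eqVneq i j; first by rewrite dfwithin vK.
  by rewrite dfwithout// mul0mx.
pose u i m : 'rV[R]_(rdegree (V i)) :=
  if (m < N)%N then 0 else
  oapp (fun j : 'I_#|gT| => w (enum_val j) i) 0 (insub (m - N)%N).
have u0 i m : ~~ (N <= m < N + #|gT|)%N -> u i m = 0.
  rewrite /u; case: (ltnP m N) => //= Nm.
  rewrite -leqNgt => mN.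
  by rewrite insubN// -leqNgt leq_subRL.
have fu : exists M, forall i m, (M <= m)%N -> u i m = 0.
  by exists (N + #|gT|)%N => i m Mm; rewrite u0// negb_and -leqNgt Mm orbT.
exists (DSum fu) => //; apply/setP => g; rewrite inE; apply/eqP/idP => [ug|gK].
  (* The action uses inverses, so the copy to look at is that of [g^-1]. *)
  apply: contraT; rewrite -groupV => /(wP g^-1%g).2[i /negP[]]; apply/eqP.
  have := congr1 (fun v : dsum V => v i (N + enum_rank g^-1%g)%N) ug.
  rewrite /= /u ltnNge leq_addr /= addKn.
  by rewrite (valK (enum_rank _)) /= enum_rankK.
apply: dsum_eq => i m /=; rewrite /u; case: ifP => _; first by rewrite mul0mx.
case: insub => [j|] /=; last by rewrite mul0mx.
by apply: (wP _).1; rewrite groupV.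
Qed.

End Representations.

(** * The linking simplex *)

Section LinkingSimplexMaps.
Local Open Scope quotient_scope.
Variables (R : realType) (gT : finGroupType) (n : nat).
Variable H : 'I_n.+1 -> {group gT}.
Hypothesis chainH : forall i j : 'I_n.+1, (i < j)%N -> H i \proper H j.

Local Notation L := (linking_simplex R H).

Definition link_pt (g : gT) (x : simplex R n) : L :=
  \pi_L (g : discrete_topology gT, x).

Lemma link_ptP (z : L) : exists g x, z = link_pt g x.
Proof.
by exists (repr z).1, (repr z).2; rewrite /link_pt -surjective_pairing reprK.
Qed.

Lemma gact_link_pt a g x : gact a (link_pt g x) = link_pt (a * g)%g x.
Proof. exact: link_act_pi. Qed.

Lemma chain_sub (i j : 'I_n.+1) : (i <= j)%N -> H i \subset H j.
Proof.
rewrite leq_eqVlt => /predU1P[/val_inj->//|/chainH]; exact: proper_sub.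
Qed.

Lemma last_nonzero_ge (x : simplex R n) j : set_val x 0 j != 0 ->
  exists2 k, last_nonzero x k & (k <= rev_ord j)%N.
Proof.
move=> xj; pose P i := set_val x 0 i != 0.
have [i Pi maxi] := @arg_maxnP _ j P val xj.
exists (rev_ord i); last by apply: leq_sub2l; exact: maxi.
apply/andP; rewrite rev_ordK; split=> //; apply/forallP => l.
apply/implyP; apply: contraLR => xl; rewrite -leqNgt; exact: maxi.
Qed.

(** The identification is governed by the smallest group [H k] with [last_nonzero
    x k]; asking for all nonzero coordinates at once is equivalent, since
    their groups contain [H k], and spares the mention of [k]. *)
Lemma link_pt_eqP g h (x : simplex R n) :
  reflect (forall j, set_val x 0 j != 0 -> (g^-1 * h)%g \in H (rev_ord j))
          (link_pt g x == link_pt h x).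
Proof.
apply: (iffP eqP) => [/link_piP/andP[_ /forallP eqgh] j xj|gh].
  have [k xk kj] := last_nonzero_ge xj.
  apply: (fintype.subsetP (chain_sub kj)); rewrite -mem_lcoset.
  by rewrite (eqP (implyP (eqgh k) xk)) lcoset_refl.
apply/link_piP; rewrite /link_eq eqxx /=; apply/forallP => k; apply/implyP.
move=> /andP[/gh]; rewrite rev_ordK => ghk _.
by rewrite eq_sym; apply/eqP/lcoset_eqP; rewrite mem_lcoset.
Qed.

Lemma isotropy_link_pt g (x : simplex R n) : isotropy (link_pt g x) =
  [set a | [forall j, (set_val x 0 j != 0) ==> (a ^ g \in H (rev_ord j))%g]]%SET.
Proof.
apply/setP => a; rewrite !inE gact_link_pt eq_sym.
apply/link_pt_eqP/forallP => [ax j|ax j xj].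
  by apply/implyP => xj; rewrite conjgE; exact: ax.
by have := implyP (ax j) xj; rewrite conjgE.
Qed.

(** The affine extension of vectors [w j g] attached to the vertices, read off
    representatives; it agrees with its formula at every [link_pt g x] once
    [w j g] depends only on the coset of [g] modulo the group of the vertex [j]
    ([link_liftE]). *)
Definition link_lift (W : lmodType R) (w : 'I_n.+1 -> gT -> W) (z : L) : W :=
  \sum_j set_val (repr z).2 0 j *: w j (repr z).1.

Lemma link_liftE (W : lmodType R) (w : 'I_n.+1 -> gT -> W) g
    (x : simplex R n) :
  (forall j g h, h \in H (rev_ord j) -> w j (g * h)%g = w j g) ->
  link_lift w (link_pt g x) = \sum_j set_val x 0 j *: w j g.
Proof.
move=> wH; rewrite /link_lift.
have : link_pt (repr (link_pt g x)).1 (repr (link_pt g x)).2 = link_pt g x.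
  by rewrite /link_pt -surjective_pairing reprK.
case: (repr _) => h y /= hygx.
have /andP[/eqP /= yx _] : link_eq H (h : discrete_topology gT, y) (g, x).
  exact/link_piP.
rewrite yx in hygx *; apply: eq_bigr => j _.
have [->|xj] := eqVneq (set_val x 0 j) 0; first by rewrite !scale0r.
by have /eqP/link_pt_eqP/(_ j xj)/wH <- := hygx; rewrite mulKVg.
Qed.

Lemma link_lift_continuous (W : normedModType R) (w : 'I_n.+1 -> gT -> W) :
  (forall j g h, h \in H (rev_ord j) -> w j (g * h)%g = w j g) ->
  continuous (link_lift w).
Proof.
move=> wH; apply/quotient_continuous.
rewrite (_ : _ \o _ = fun p : discrete_topology gT * simplex R n =>
    \sum_j set_val p.2 0 j *: w j p.1); last first.
  by apply/funext => -[g x]; exact: link_liftE.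
move=> p; apply: cvg_big => [|j _]; first exact: add_continuous.
apply: cvgZ.
  apply: (@continuous_comp _ _ _ snd (fun x : simplex R n => set_val x 0 j)).
    exact: cvg_snd.
  move=> x; apply: (@continuous_comp _ _ _ _ (fun v : 'rV[R]_n.+1 => v 0 j)).
    exact: set_val_continuous.
  exact: coord_continuous.
apply: (@continuous_comp _ _ _ fst (w j : discrete_topology gT -> W)).
  exact: cvg_fst.
have cw : continuous (w j : discrete_topology gT -> W).
  by apply/continuousP => A _; exact: discrete_open.
exact: cw.
Qed.

Lemma compact_linking_simplex : compact [set: L].
Proof.
have cGD : compact [set: discrete_topology gT * simplex R n].
  apply: compactT_setX; last exact: compact_simplex.
  by apply: finite_compact; exact: (@finite_finset gT).
have -> : [set: L] = \pi_L @` [set: discrete_topology gT * simplex R n].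
  by apply/seteqP; split=> // z _; exists (repr z) => //; rewrite reprK.
apply: continuous_compact cGD; apply: continuous_subspaceT.
exact: pi_continuous.
Qed.

(** Affine extensions with values in [R] separate points: extending the indicator
    of the vertex [j] gives the coordinate [x_j], and extending the indicator of
    the coset of [g] at the vertex [j] detects whether [g] and [g'] are in the
    same coset, as long as [x_j] is nonzero. *)
Lemma hausdorff_linking_simplex : hausdorff_space L.
Proof.
apply: (@hausdorff_separating R) => z z' sep.
have [g [x zE]] := link_ptP z; have [g' [x' z'E]] := link_ptP z'; subst z z'.
have {}sep (w : 'I_n.+1 -> gT -> R) :
    (forall j g h, h \in H (rev_ord j) -> w j (g * h)%g = w j g) ->
    \sum_j set_val x 0 j * w j g = \sum_j set_val x' 0 j * w j g'.
  move=> wH; have /= := sep _ (link_lift_continuous (W := R^o) wH).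
  by rewrite !link_liftE.
have sum1 (y : simplex R n) (j : 'I_n.+1) (c : R) :
    \sum_i set_val y 0 i * ((i == j)%:R * c) = set_val y 0 j * c.
  rewrite (bigD1 j)//= eqxx mul1r big1 ?addr0// => i /negbTE ->.
  by rewrite mul0r mulr0.
have xx' : x = x'.
  apply/val_inj/rowP => j.
  have := sep (fun i _ => (i == j)%:R * 1) (fun _ _ _ _ => erefl).
  by rewrite !sum1 !mulr1.
rewrite -xx'; apply/eqP/link_pt_eqP => j xj.
pose w (i : 'I_n.+1) (a : gT) : R :=
  (i == j)%:R * ((g^-1 * a)%g \in H (rev_ord j))%:R.
have wH i a h : h \in H (rev_ord i) -> w i (a * h)%g = w i a.
  rewrite /w; have [->|] := eqVneq i j => hH; last by rewrite !mul0r.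
  by rewrite mulgA groupMr.
have := sep w wH; rewrite -xx' !sum1 mulVg group1 => /(mulfI xj).
by case: (_ \in _) => // /eqP; rewrite oner_eq0.
Qed.

End LinkingSimplexMaps.

(** * Isotropy and isovariant maps into the direct sum *)

Section GSpaces.
Variable gT : finGroupType.

Lemma isotropy_gact (X : gSpaceType gT) (a g : gT) (x : X) :
  (a \in isotropy (gact g x)) = ((a ^ g)%g \in isotropy x).
Proof.
rewrite !inE conjgE gactM gactM; apply/eqP/eqP => [->|ag].
  by rewrite -gactM mulVg gact1.
by rewrite -[gact a _]gact1 -(mulgV g) gactM ag.
Qed.

Lemma isotropy_inj (X Y : gSpaceType gT) (f : X -> Y) :
  injective f -> (forall (g : gT) x, f (gact g x) = gact g (f x)) ->
  forall x, isotropy (f x) = isotropy x.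
Proof. by move=> injf fG x; apply/setP => g; rewrite !inE -fG (inj_eq injf). Qed.

Lemma isovariant_comp (X Y Z : gSpaceType gT) (f : X -> Y) (g : Y -> Z) :
  isovariant f -> isovariant g -> isovariant (g \o f).
Proof.
move=> [cf fG fI] [cg gG gI]; split=> [x|a x|x] /=.
- by apply: continuous_comp; [exact: cf|exact: cg].
- by rewrite fG gG.
- by rewrite fI gI.
Qed.

End GSpaces.

Section DirectSumIsotropy.
Variables (R : realType) (gT : finGroupType) (k : nat).
Variable V : 'I_k -> representation R [set: gT].

Lemma dsum_sumE (I : finType) (F : I -> dsum V) i m :
  (\sum_j F j) i m = \sum_j F j i m.
Proof. by elim/big_rec2 : _ => // j u v _ <-. Qed.

(** In the copies of index at least [N] the sum is a nonzero multiple of [v], so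
    it is not fixed by more than [v] is, whatever [u] and [u0] add up to. *)
Lemma isotropy_dsum_perturb (N : nat) (a b c : R) (u u0 v : dsum V) :
  (forall i m, (N <= m)%N -> u i m = 0) ->
  (forall i m, (N <= m)%N -> u0 i m = 0) ->
  (forall i m, (m < N)%N -> v i m = 0) ->
  isotropy u = isotropy v -> isotropy u0 = isotropy v -> c != 0 ->
  isotropy (a *: u + b *: u0 + c *: v) = isotropy v.
Proof.
move=> uN u0N vN uv u0v c0; apply/setP => g; rewrite !inE.
apply/eqP/eqP => [fixg|vg].
  apply: dsum_eq => i m /=; have [Nm|mN] := leqP N m; last first.
    by rewrite vN// mul0mx.
  have /= := congr1 (fun w : dsum V => w i m) fixg.
  rewrite uN// u0N// !scaler0 !add0r -scalemxAl => /(congr1 ( *:%R c^-1)).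
  by rewrite !scalerA mulVf// !scale1r.
have gv : g \in isotropy v by rewrite inE vg.
have ug : gact g u = u by move: gv; rewrite -uv inE => /eqP.
have u0g : gact g u0 = u0 by move: gv; rewrite -u0v inE => /eqP.
apply: dsum_eq => i m /=; have fix_coord (w : dsum V) : gact g w = w ->
    w i m *m V i g^-1%g = w i m by move=> gw; rewrite -[in RHS]gw.
by rewrite !mulmxDl -!scalemxAl !fix_coord.
Qed.

Section IsovariantEmbedding.
Hypothesis irrV : irr_representatives V.
Variables (n : nat) (H : 'I_n.+1 -> {group gT}).
Hypothesis chainH : forall i j : 'I_n.+1, (i < j)%N -> H i \proper H j.

(** The vertex [j] of the simplex has isotropy [H (rev_ord j)] and is sent to a
    vector [v j] with that stabiliser, supported in a block of copies of its own.
    In this block the affine extension is [x_j *: g v_j], so that an element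
    fixing the sum fixes every [g v_j] with [x_j] nonzero. *)
Lemma exists_isovariant_dsum (N : nat) :
  exists2 e : linking_simplex R H -> dsum V,
    isovariant e & forall z i m, (m < N)%N -> e z i m = 0.
Proof.
pose c := #|gT|.
have /choice[v vP] : forall j : 'I_n.+1, exists v : dsum V,
    (forall i m, ~~ (N + j * c <= m < N + j * c + c)%N -> v i m = 0) /\
    isotropy v = H (rev_ord j).
  move=> j.
  have [v v0 vH] := exists_dsum_isotropy irrV (H (rev_ord j)) (N + j * c).
  by exists v.
(* A copy lies in at most one of the consecutive blocks of length [c]. *)
have block m : exists j : nat, forall i : 'I_n.+1, i <> j :> nat ->
    ~~ (N + i * c <= m < N + i * c + c)%N.
  exists ((m - N) %/ c)%N => i ij; apply/negP => /andP[im mi]; apply: ij.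
  have c0 : (0 < c)%N by apply/card_gt0P; exists 1%g.
  apply/eqP; rewrite eq_sym eqn_leq leq_divRL// -ltnS ltn_divLR//.
  rewrite mulSn addnC; lia.
pose w (j : 'I_n.+1) g := gact g (v j).
have wH j g h : h \in H (rev_ord j) -> w j (g * h)%g = w j g.
  by rewrite -(vP j).2 inE /w gactM => /eqP ->.
pose e := link_lift (W := dsum V) (H := H) w.
have eE g x : e (link_pt H g x) = \sum_j set_val x 0 j *: w j g.
  exact: link_liftE.
have eG a z : e (gact a z) = gact a (e z).
  have [g [x ->]] := link_ptP z; rewrite gact_link_pt !eE.
  apply: dsum_eq => i m; rewrite /= !dsum_sumE mulmx_suml.
  by apply: eq_bigr => j _; rewrite /w gactM /= -scalemxAl.
have e0 z i m : (m < N)%N -> e z i m = 0.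
  move=> mN; rewrite /e /link_lift dsum_sumE big1// => j _.
  rewrite /= (vP j).1 ?mul0mx ?scaler0//.
  by rewrite negb_and -ltnNge (leq_trans mN) ?leq_addr.
exists e => //; split=> //.
  apply: (@dsum_continuous _ _ _ _ _ (N + n.+1 * c)%N) => [z i m Nm|i m].
    rewrite /e /link_lift dsum_sumE big1// => j _.
    rewrite /= (vP j).1 ?mul0mx ?scaler0//.
    rewrite negb_and; apply/orP; right; rewrite -leqNgt; apply: leq_trans Nm.
    by rewrite -addnA leq_add2l -mulSnr leq_mul2r ltn_ord orbT.
  rewrite (_ : (fun z => _) = link_lift (H := H) (fun j g => w j g i m)).
    by apply: link_lift_continuous => // j g h hH; rewrite wH.
  by apply/funext => z; rewrite /e /link_lift dsum_sumE.
move=> z; have [g [x ->]] := link_ptP z; apply/setP => a.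
have wfix j : (gact a (w j g) == w j g) = (a ^ g \in H (rev_ord j))%g.
  by rewrite -(vP j).2 -isotropy_gact inE.
rewrite isotropy_link_pt// inE inE -eG gact_link_pt !eE.
apply/forallP/eqP => [fixg|fixe j].
  apply: eq_bigr => j _; have [->|xj] := eqVneq (set_val x 0 j) 0.
    by rewrite !scale0r.
  by have := implyP (fixg j) xj; rewrite -wfix /w gactM => /eqP ->.
apply/implyP => xj; rewrite -wfix; apply/eqP; rewrite /w -gactM -/(w j _).
apply: dsum_eq => i m; have [l lP] := block m.
have [jl|jl] := eqVneq (j : nat) l; last first.
  by rewrite /= (vP j).1 ?mul0mx//; apply: lP; exact/eqP.
have coordE h : (e (link_pt H h x)) i m = set_val x 0 j *: w j h i m.
  rewrite eE dsum_sumE (bigD1 j)//= big1 ?addr0// => l' l'j.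
  rewrite /= (vP l').1 ?mul0mx ?scaler0//; apply: lP => l'l.
  by move/eqP: l'j; apply; apply/val_inj; rewrite /= l'l.
have := congr1 (fun u : dsum V => u i m) fixe.
rewrite -!eE /= !coordE => /(congr1 ( *:%R (set_val x 0 j)^-1)).
by rewrite !scalerA mulVf// !scale1r.
Qed.

End IsovariantEmbedding.
End DirectSumIsotropy.

(** * Spaces of isovariant maps *)

Section IsovariantMappingSpace.
Variable gT : finGroupType.
Variables X U : gSpaceType gT.

Definition isvt_fun (p : isvt_map X U) : X -> U :=
  set_val (p : set_type [set f : {compact-open, X -> U} | isovariant f]).

Lemma isvt_funP (p : isvt_map X U) : isovariant (isvt_fun p).
Proof. by apply: set_valP. Qed.

Definition to_isvt (f : X -> U) (isof : isovariant f) : isvt_map X U :=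
  SigSub (mem_set (isof : [set f : {compact-open, X -> U} | isovariant f] f)).

Lemma isvt_fun_inj : injective isvt_fun.
Proof. exact: val_inj. Qed.

Lemma to_isvtK (f : X -> U) (isof : isovariant f) : isvt_fun (to_isvt isof) = f.
Proof. by []. Qed.

(** [X] being compact Hausdorff makes evaluation jointly continuous. *)
Lemma isvt_fun_uncurry_continuous (T : topologicalType) (f : T -> isvt_map X U) :
  compact [set: X] -> hausdorff_space X -> continuous f ->
  continuous (fun p : T * X => isvt_fun (f p.1) p.2).
Proof.
move=> cX hX /kspace_continuous cf.
rewrite (_ : (fun p => _) = uncurry (fun t => isvt_fun (f t))); last first.
  by apply/funext => -[].
apply: compact_hausdorff_uncurry => //.
  move=> t; apply: (@continuous_comp T
    (set_type [set g : {compact-open, X -> U} | isovariant g]) _ f set_val).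
    exact: cf.
  exact: set_val_continuous.
by move=> t; have [] := isvt_funP (f t).
Qed.

(** Conversely, currying is always continuous for the compact-open topology; the
    hypotheses on [T] account for the compactly generated refinement. *)
Lemma to_isvt_continuous (T : topologicalType) (h : T * X -> U)
    (isoh : forall t, isovariant (fun x => h (t, x))) :
  compact [set: T] -> hausdorff_space T -> continuous h ->
  continuous (fun t => to_isvt (isoh t)).
Proof.
move=> cT hT ch; apply: continuous_kspace => //.
apply: (@continuous_comp_initial _ _ _ set_val) => t.
exact: (continuous_curry_fun ch).
Qed.

End IsovariantMappingSpace.

(** * The null homotopy *)

Section Bump.
Variables (R : realType) (n : nat).

Definition bump (s : cube R n) : R :=
  \prod_i (set_val s 0 i * (1 - set_val s 0 i)).

Lemma bump_continuous : continuous bump.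
Proof.
move=> s.
apply: (@cvg_big _ _ _ _ _ (@mul_continuous R) _ _ _ _ _ (nbhs_filter s)) => i _.
apply: cvgM; first exact: cube_coord_continuous.
by apply: cvgB; [exact: cvg_cst|exact: cube_coord_continuous].
Qed.

Lemma bump_eq0 s : bump s = 0 <-> cube_boundary s.
Proof.
split=> [/eqP/prodf_eq0[i _]|[i si]].
  rewrite mulf_eq0 subr_eq0 => /orP[/eqP|/eqP]; first by exists i; left.
  by exists i; right.
apply/eqP/prodf_eq0; exists i => //; rewrite mulf_eq0 subr_eq0.
by case: si => ->; rewrite eqxx ?orbT.
Qed.

End Bump.

Section Contraction.
Variables (R : realType) (gT : finGroupType) (k : nat).
Variable V : 'I_k -> representation R [set: gT].
Variable X : gSpaceType gT.
Hypotheses (cX : compact [set: X]) (hX : hausdorff_space X).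
(** Isovariant maps into [dsum V] that avoid any given finite number of copies:
    this is all that the contraction uses about the compact Hausdorff [X]. *)
Hypothesis embX : forall N, exists2 e : X -> dsum V,
  isovariant e & forall x i m, (m < N)%N -> e x i m = 0.
Variables (U : gRepType gT R) (phi : U -> dsum V) (psi : dsum V -> U).
Hypothesis phi_equivariant : forall (g : gT) u, phi (gact g u) = gact g (phi u).
Hypotheses (phiK : cancel phi psi) (psiK : cancel psi phi).
Hypotheses (cphi : continuous phi) (cpsi : continuous psi).

Lemma isovariant_phi : isovariant phi.
Proof.
split=> // u; apply/esym/isotropy_inj => //; exact: can_inj phiK.
Qed.

Lemma isovariant_psi : isovariant psi.
Proof.
have psi_equivariant (g : gT) v : psi (gact g v) = gact g (psi v).
  by rewrite -{1}[v]psiK -phi_equivariant phiK.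
by split=> // u; apply/esym/isotropy_inj => //; exact: can_inj psiK.
Qed.

(** The homotopy is the combination of [f], [x0] and a remote isovariant [e]
    with coefficients [1 - t], [t] and [t (1 - t) bump(s)].  Adding [e] keeps the
    path from [f(s)] to [x0] inside isovariant maps; its coefficient vanishes at
    both ends and over the boundary of the cube, which makes the homotopy
    relative to the boundary without any further adjustment. *)
Lemma isvt_map_weakly_contractible : weakly_contractible R (isvt_map X U).
Proof.
split.
  have [e isoe _] := embX 0.
  by exists (to_isvt (isovariant_comp isoe isovariant_psi)).
move=> n x0 f cf fbd.
pose F (p : cube R n * X) : dsum V := phi (isvt_fun (f p.1) p.2).
pose F0 (x : X) : dsum V := phi (isvt_fun x0 x).
have cF : continuous F.
  move=> p; apply: continuous_comp; last exact: cphi.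
  exact: (isvt_fun_uncurry_continuous cX hX cf).
have cF0 : continuous F0.
  move=> x; apply: continuous_comp; last exact: cphi.
  by have [+ _ _] := isvt_funP x0; exact.
have [N1 FN1] := compact_dsum_bounded (compactT_setX (@compact_cube R n) cX) cF.
have [N2 FN2] := compact_dsum_bounded cX cF0.
pose N := maxn N1 N2.
have FN p i m : (N <= m)%N -> F p i m = 0.
  by rewrite geq_max => /andP[+ _]; exact: FN1.
have F0N x i m : (N <= m)%N -> F0 x i m = 0.
  by rewrite geq_max => /andP[_]; exact: FN2.
have [e [ce eG eI] eN] := embX N.
pose T := (cube R n * unit_interval R)%type.
pose tt (t : unit_interval R) : R := set_val t.
pose h (p : T * X) : dsum V :=
  (1 - tt p.1.2) *: F (p.1.1, p.2) + tt p.1.2 *: F0 p.2 +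
  (tt p.1.2 * (1 - tt p.1.2) * bump p.1.1) *: e p.2.
have cTX : compact [set: T * X].
  apply: compactT_setX cX.
  exact: (compactT_setX (@compact_cube R n) (@compact_unit_interval R)).
have c1 : continuous (fun p : T * X => p.1.1).
  by move=> p; apply: (@continuous_comp _ _ _ fst fst); exact: cvg_fst.
have c2 : continuous (fun p : T * X => p.2) by move=> p; exact: cvg_snd.
have ctt : continuous (fun p : T * X => tt p.1.2).
  move=> p; apply: (@continuous_comp _ _ _ (fun p : T * X => p.1.2) tt).
    by apply: (@continuous_comp _ _ _ fst snd); [exact: cvg_fst|exact: cvg_snd].
  exact: set_val_continuous.
have ctt' : continuous (fun p : T * X => 1 - tt p.1.2).
  by move=> p; apply: cvgB; [exact: cvg_cst|exact: ctt].
have cbump : continuous (fun p : T * X => bump p.1.1).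
  move=> p; apply: (@continuous_comp _ _ _ (fun p : T * X => p.1.1) (@bump R n)).
    exact: c1.
  exact: bump_continuous.
have ch : continuous h.
  apply: compact_dsum_add_continuous => //.
    apply: compact_dsum_add_continuous => //;
      apply: compact_dsum_scale_continuous => //.
      move=> p; apply: (@continuous_comp _ _ _ (fun p : T * X => (p.1.1, p.2)) F).
        exact: continuous_pair.
      exact: cF.
    move=> p; apply: (@continuous_comp _ _ _ (fun p : T * X => p.2) F0).
      exact: c2.
    exact: cF0.
  apply: compact_dsum_scale_continuous => // p.
    by apply: cvgM; [apply: cvgM; [exact: ctt|exact: ctt']|exact: cbump].
  apply: (@continuous_comp _ _ _ (fun p : T * X => p.2) e); first exact: c2.
  exact: ce.
have isoF s : isovariant (fun x => F (s, x)).
  exact: (isovariant_comp (isvt_funP (f s)) isovariant_phi).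
have isoF0 : isovariant F0.
  exact: (isovariant_comp (isvt_funP x0) isovariant_phi).
have h0 s t x : tt t = 0 -> h ((s, t), x) = F (s, x).
  by move=> t0; rewrite /h /= t0 !mul0r !scale0r subr0 scale1r !addr0.
have h1 s t x : tt t = 1 -> h ((s, t), x) = F0 x.
  by move=> t1; rewrite /h /= t1 subrr mulr0 mul0r !scale0r scale1r add0r addr0.
have hbd s t x : cube_boundary s -> h ((s, t), x) = F0 x.
  move=> sbd; rewrite /h /= (iffRL (bump_eq0 s) sbd) mulr0 scale0r addr0.
  by rewrite /F /= fbd// -/(F0 x) -scalerDl subrK scale1r.
have isoh (st : T) : isovariant (fun x => h (st, x)).
  case: st => s t.
  have [t0|t0] := eqVneq (tt t) 0.
    rewrite (_ : (fun x => _) = fun x => F (s, x)) //.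
    by apply/funext => x; rewrite h0.
  have [t1|t1] := eqVneq (tt t) 1.
    by rewrite (_ : (fun x => _) = F0) //; apply/funext => x; rewrite h1.
  have [sbd|sbd] := pselect (cube_boundary s).
    by rewrite (_ : (fun x => _) = F0) //; apply/funext => x; rewrite hbd.
  split=> [x|g x|x].
  - apply: (@continuous_comp _ _ _ (pair (s, t)) h); last exact: ch.
    have cst_c : continuous (fun _ : X => (s, t)) by exact: cst_continuous.
    have id_c : continuous (@id X) by move=> y; exact: cvg_id.
    exact: (continuous_pair cst_c id_c).
  - have [_ FG _] := isoF s; have [_ F0G _] := isoF0.
    rewrite /h /= FG F0G eG; apply: dsum_eq => i m /=.
    by rewrite !mulmxDl -!scalemxAl.
  rewrite /h /= (isotropy_dsum_perturb (N := N)) //.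
  - by move=> i m; exact: FN.
  - by move=> i m; exact: F0N.
  - by move=> i m; exact: eN.
  - by have [_ _ FI] := isoF s; exact: etrans (esym (FI x)) (eI x).
  - by have [_ _ F0I] := isoF0; exact: etrans (esym (F0I x)) (eI x).
  rewrite !mulf_neq0// ?subr_eq0 1?eq_sym//.
  by apply/eqP => b0; apply: sbd; apply/(bump_eq0 s).
pose hU (p : T * X) : U := psi (h p).
have isohU (st : T) : isovariant (fun x => hU (st, x)).
  exact: (isovariant_comp (isoh st) isovariant_psi).
exists (fun st => to_isvt (isohU st)); split.
- apply: to_isvt_continuous.
  + exact: (compactT_setX (@compact_cube R n) (@compact_unit_interval R)).
  + exact: hausdorff_cube_cylinder.
  + by move=> p; apply: continuous_comp; [exact: ch|exact: cpsi].
- move=> s t t0; apply: isvt_fun_inj; rewrite to_isvtK; apply/funext => x.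
  by rewrite /hU h0// phiK.
- move=> s t t1; apply: isvt_fun_inj; rewrite to_isvtK; apply/funext => x.
  by rewrite /hU h1// phiK.
- move=> s t sbd; apply: isvt_fun_inj; rewrite to_isvtK; apply/funext => x.
  by rewrite /hU hbd// phiK.
Qed.

End Contraction.

Theorem theorem5p5 (R : realType) (gT : finGroupType) (U : gRepType gT R)
    (hU : complete_universe U)
    (n : nat) (H : 'I_n.+1 -> {group gT})
    (hH : forall i j : 'I_n.+1, (i < j)%N -> H i \proper H j) :
  weakly_contractible R (isvt_map (linking_simplex R H) U).
Proof.
have [k [V [irrV [phi [psi [_ phiG phiK psiK [cphi cpsi]]]]]]] := hU.
apply: (isvt_map_weakly_contractible _ _ _ phiG phiK psiK cphi cpsi).
- exact: compact_linking_simplex.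
- exact: hausdorff_linking_simplex.
- exact: exists_isovariant_dsum.
Qed.
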